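(* Let $\chi$ be any Dirichlet character of conductor $f$. For every $k\in\mathbb{N}$, $$ \sum_{\nu=2}^{k+1} \nu\,L_2^{\mathrm{sh}}(k+2-\nu,\nu+1;\chi,\chi_0)+(k+1)L_2^{\mathrm{sh}}(1,k+2;\chi_0,\chi)+L_2^{\mathrm{sh}}(2,k+1;\chi_0,\chi)-L_2^{\ast}(2,k+1;\chi_0,\chi)=L(k+3;\chi). $$ In particular, for every $k\in\mathbb{N}$, $$ \sum_{\nu=2}^{k} \nu\,\zeta_2(k+2-\nu,\nu+1) +2(k+1)\zeta_2(1,k+2)=\zeta(k+3). $$
   Context: $\mathbb{N}$ is the set of positive integers; empty sums are $0$. A Dirichlet character $\chi$ of conductor $f$ is regarded as a primitive character modulo $f$. $\chi_0$ is the trivial character, $\chi_0(n)=1$ for all $n$. $L(s;\chi)=\sum_{n\geq 1}\chi(n)n^{-s}$ is the Dirichlet $L$-function and $\zeta$ is the Riemann zeta-function. For Dirichlet characters $\psi_1,\psi_2$, the double $L$-functions are $$L_2^{\ast}(s_1,s_2;\psi_1,\psi_2)=\sum_{m\geq 1,\, n\geq 1}\frac{\psi_1(m)\psi_2(m+n)}{m^{s_1}(m+n)^{s_2}},\qquad L_2^{\mathrm{sh}}(s_1,s_2;\psi_1,\psi_2)=\sum_{m\geq 1,\, n\geq 1}\frac{\psi_1(m)\psi_2(n)}{m^{s_1}(m+n)^{s_2}}$$ (the superscript $\mathrm{sh}$ stands for the shuffle symbol). The double zeta values are $$\zeta_2(k_1,k_2)=\sum_{m=1}^\infty\sum_{n=1}^\infty\frac{1}{m^{k_1}(m+n)^{k_2}}\qquad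 (k_1,k_2\in\mathbb{N},\ k_2>1).$$ *)

(* Defs.v *)
From mathcomp Require Import all_boot all_order all_algebra complex.
From mathcomp Require Import all_classical all_reals all_analysis.
Set Implicit Arguments.
Unset Strict Implicit.
Unset Printing Implicit Defensive.
Import Order.TTheory GRing.Theory Num.Theory.
Import numFieldNormedType.Exports.
Local Open Scope ring_scope.

(* Complex values live in [R[i]^o], the field of complex numbers seen as a
   normed module over itself: this is the alias that carries the topology, so
   that the limits hidden in [\sum_(m <= n <oo)] are taken for the modulus. *)

Notation "\sum_ ( m <= i '<oo' ) F" :=
  (\big[+%R/0%R]_(m <= i <oo) F%R) : ring_scope.

Section DirichletCharacters.
Variable R : realType.
Implicit Types (f d : nat) (chi psi : nat -> R[i]^o).

Definition dirichlet_char f chi : Prop :=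
  [/\ (0 < f)%N,
      forall m n, chi (m * n)%N = chi m * chi n,
      forall n, chi (n + f)%N = chi n
    & forall n, (chi n != 0) = coprime n f].

Definition induced_from d f chi : Prop :=
  exists psi, dirichlet_char d psi /\
    forall n, coprime n f -> chi n = psi n.

(* "of conductor f", with chi regarded as a primitive character modulo f *)
Definition primitive_char f chi : Prop :=
  dirichlet_char f chi /\
  forall d, (d %| f)%N -> induced_from d f chi -> d = f.

Definition chi0 : nat -> R[i]^o := fun _ => 1.

End DirichletCharacters.

Arguments chi0 {R}.

(* Exponents are natural numbers: no other point (s1, s2) is needed here. The
   double series are iterated, which agrees with any other order of
   summation where they converge absolutely, e.g. for s2 > 1 and s1 + s2 > 2. *)

Definition dirichletL (R : realType) (s : nat) (chi : nat -> R[i]^o) : R[i]^o :=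
  \sum_(1 <= n <oo) chi n / n%:R ^+ s.

Definition L2star (R : realType) (s1 s2 : nat) (psi1 psi2 : nat -> R[i]^o)
    : R[i]^o :=
  \sum_(1 <= m <oo) \sum_(1 <= n <oo)
    psi1 m * psi2 (m + n)%N / (m%:R ^+ s1 * (m + n)%:R ^+ s2).

Definition L2sh (R : realType) (s1 s2 : nat) (psi1 psi2 : nat -> R[i]^o)
    : R[i]^o :=
  \sum_(1 <= m <oo) \sum_(1 <= n <oo)
    psi1 m * psi2 n / (m%:R ^+ s1 * (m + n)%:R ^+ s2).

Definition zeta (R : realType) (k : nat) : R :=
  \sum_(1 <= n <oo) ((n%:R ^+ k)^-1 : R).

Definition zeta2 (R : realType) (k1 k2 : nat) : R :=
  \sum_(1 <= m <oo) \sum_(1 <= n <oo) ((m%:R ^+ k1 * (m + n)%:R ^+ k2)^-1 : R).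

(* Main.v *)
(** The identity holds for every bounded chi, because it holds coefficientwise
    in chi l.  Partial fractions in n give, for fixed l,
      sum_(2 <= nu <= k+1) nu / (l^(k+2-nu) (l+n)^(nu+1))
        + (k+1) / (n (n+l)^(k+2)) + 1 / (n^2 (n+l)^(k+1))
      = (1/n^2 - 1/(n+l)^2) / l^(k+1);
    the sum over n of the right-hand side telescopes to
    l^-(k+1) sum_(m <= l) 1/m^2, and the terms m < l are those of L2star.
    All double series have terms of size O(1/(m^2 n^2)), so that the order of
    summation is irrelevant.  The identity for zeta is the case chi = chi0,
    where L2star 2 (k+1) cancels against L2sh 2 (k+1). *)

Require Import Defs.
From mathcomp Require Import all_boot all_order all_algebra complex.
From mathcomp Require Import all_classical all_reals all_analysis.
From mathcomp Require Import ring zify.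
Import Order.TTheory GRing.Theory Num.Theory.
Import numFieldNormedType.Exports.
Local Open Scope ring_scope.
Set Implicit Arguments.
Unset Strict Implicit.
Unset Printing Implicit Defensive.

Local Open Scope classical_set_scope.

(** * Double series summed by squares and by rows *)

Definition square_sum (K : numFieldType) (a : nat -> nat -> K^o) (N : nat) : K^o :=
  \sum_(1 <= m < N) \sum_(1 <= n < N) a m n.

(* The limit of the square partial sums does not see the order of summation:
   this is what makes the two iterated sums of [a] comparable. *)
Definition dsum (K : numFieldType) (a : nat -> nat -> K^o) (S : K^o) : Prop :=
  square_sum a N @[N --> \oo] --> S /\
  exists r : nat -> K^o,
    (forall m, (0 < m)%N -> \sum_(1 <= n < N) a m n @[N --> \oo] --> r m) /\
    \sum_(1 <= m < M) r m @[M --> \oo] --> S.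

(** The bound is symmetric in [m] and [n], so it survives transposition. Over the complex numbers
    the inequality itself forces [B] to be real. *)
Definition dominated (K : numFieldType) (a : nat -> nat -> K^o) : Prop :=
  exists B : K, forall m n, (0 < m)%N -> (0 < n)%N ->
    `|a m n| <= B / (m ^ 2 * n ^ 2)%:R.

Section DoubleSums.
Variable K : numFieldType.
Implicit Types (a b : nat -> nat -> K^o) (S T : K^o).

Lemma cvg_sum_nat (p q : nat) (F : nat -> nat -> K^o) (l : nat -> K^o) :
  (forall i, (p <= i < q)%N -> F i N @[N --> \oo] --> l i) ->
  \sum_(p <= i < q) F i N @[N --> \oo] --> \sum_(p <= i < q) l i.
Proof.
move=> Fl; rewrite big_nat; under eq_fun do rewrite big_nat.
by apply: (@cvg_big K^o) => //; exact: add_continuous.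
Qed.

(** Here [u] may be the row limits themselves, as in [dsum_lim], or closed forms for them, as in the
    final identity. *)
Lemma dsum_iterated a S (u : nat -> K^o) : dsum a S ->
  (forall m, (0 < m)%N -> limn (fun N => \sum_(1 <= n < N) a m n) = u m) ->
  \sum_(1 <= m < M) u m @[M --> \oo] --> S.
Proof.
move=> [_ [r [ar rS]]] au; suff -> : (fun M => \sum_(1 <= m < M) u m) =
    (fun M => \sum_(1 <= m < M) r m) by [].
apply/funext => M; rewrite big_nat [RHS]big_nat; apply: eq_bigr => m /andP[m0 _].
by rewrite -au//; apply: cvg_lim => //; exact: ar.
Qed.

Lemma dsum_lim a S : dsum a S ->
  limn (fun M => \sum_(1 <= m < M) limn (fun N => \sum_(1 <= n < N) a m n)) = S.
Proof. by move=> aS; apply: cvg_lim => //; exact: dsum_iterated aS _. Qed.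

(** A square is its own transpose, so exchanging two finite sums shows that [a] and [b] have the
    same square sums. *)
Lemma dsum_tr_uniq a b S T :
  (forall m n, (0 < m)%N -> (0 < n)%N -> a m n = b n m) ->
  dsum a S -> dsum b T -> S = T.
Proof.
move=> ab [aS _] [bT _]; apply: (@cvg_unique _ _ _ _ _ _ aS); first by [].
suff -> : square_sum a = square_sum b by [].
apply/funext => N; rewrite /square_sum [RHS]exchange_big /=.
by apply: eq_big_nat => m /andP[m0 _]; apply: eq_big_nat => n /andP[n0 _]; exact: ab.
Qed.

Lemma dsum_uniq a S T : dsum a S -> dsum a T -> S = T.
Proof. by move=> [aS _] [aT _]; exact: cvg_unique aS aT. Qed.

Lemma eq_dsum a b S :
  (forall m n, (0 < m)%N -> (0 < n)%N -> a m n = b m n) -> dsum a S -> dsum b S.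
Proof.
move=> ab [aS [r [ar rS]]]; split.
  suff -> : square_sum b = square_sum a by [].
  apply/funext => N; rewrite /square_sum.
  by apply: eq_big_nat => m /andP[m0 _]; apply: eq_big_nat => n /andP[n0 _]; rewrite ab.
exists r; split => // m m0.
suff -> : (fun N => \sum_(1 <= n < N) b m n) = (fun N => \sum_(1 <= n < N) a m n).
  exact: ar.
by apply/funext => N; apply: eq_big_nat => n /andP[n0 _]; rewrite ab.
Qed.

Lemma dsumD a b S T : dsum a S -> dsum b T ->
  dsum (fun m n => a m n + b m n) (S + T).
Proof.
move=> [aS [r [ar rS]]] [bT [s [bs sT]]]; split.
  rewrite /square_sum; under eq_fun do under eq_bigr do rewrite big_split.
  by under eq_fun do rewrite big_split; exact: cvgD.
exists (fun m => r m + s m); split.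
  by move=> m m0; under eq_fun do rewrite big_split; apply: cvgD; [exact: ar|exact: bs].
by under eq_fun do rewrite big_split; exact: cvgD.
Qed.

Lemma dsumZ c a S : dsum a S -> dsum (fun m n => c * a m n) (c * S).
Proof.
move=> [aS [r [ar rS]]]; split.
  rewrite /square_sum; under eq_fun do under eq_bigr do rewrite -big_distrr.
  by under eq_fun do rewrite -big_distrr; exact: cvgMl_tmp.
exists (fun m => c * r m); split.
  by move=> m m0; under eq_fun do rewrite -big_distrr; apply: cvgMl_tmp; exact: ar.
by under eq_fun do rewrite -big_distrr; exact: cvgMl_tmp.
Qed.

Lemma dsumB a b S T : dsum a S -> dsum b T ->
  dsum (fun m n => a m n - b m n) (S - T).
Proof.
move=> aS bT; rewrite -[- T]mulN1r; apply: eq_dsum (dsumD aS (dsumZ (-1) bT)).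
by move=> m n _ _; rewrite mulN1r.
Qed.

Lemma dsum0 : dsum (fun _ _ => 0 : K^o) 0.
Proof.
have z n : \sum_(1 <= i < n) (0 : K^o) = 0 by rewrite big1.
split; last exists (fun=> 0).
  rewrite /square_sum; under eq_fun do (under eq_bigr do rewrite z); under eq_fun do rewrite z.
  exact: cvg_cst.
by split => [m _|]; under eq_fun do rewrite z; exact: cvg_cst.
Qed.

Lemma dsum_sum (I : eqType) (s : seq I) (a : I -> nat -> nat -> K^o) (S : I -> K^o) :
  {in s, forall i, dsum (a i) (S i)} ->
  dsum (fun m n => \sum_(i <- s) a i m n) (\sum_(i <- s) S i).
Proof.
elim: s => [|i s IH] aS.
  by rewrite big_nil; apply: eq_dsum dsum0 => m n _ _; rewrite big_nil.
rewrite big_cons; apply: eq_dsum (dsumD (aS i _) (IH _)).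
- by move=> m n _ _; rewrite big_cons.
- exact: mem_head.
- by move=> j js; apply: aS; rewrite inE js orbT.
Qed.
End DoubleSums.

(** * Domination by a multiple of 1/(m^2 n^2) *)

Lemma dominatedW (K : numFieldType) (a : nat -> nat -> K^o) (B : K)
    (d : nat -> nat -> nat) :
  (forall m n, (0 < m)%N -> (0 < n)%N -> (m ^ 2 * n ^ 2 <= d m n)%N) ->
  (forall m n, (0 < m)%N -> (0 < n)%N -> `|a m n| <= B / (d m n)%:R) ->
  dominated a.
Proof.
move=> dmn aB; exists B => m n m0 n0; apply: le_trans (aB _ _ m0 n0) _.
have mn0 : (0 < m ^ 2 * n ^ 2)%N by rewrite muln_gt0 !expn_gt0 m0 n0.
have d0 := leq_trans mn0 (dmn _ _ m0 n0).
have B0 : 0 <= B.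
  by rewrite -(pmulr_lge0 _ (_ : 0 < (d m n)%:R^-1)) ?invr_gt0 ?ltr0n// (le_trans _ (aB _ _ m0 n0)).
by rewrite ler_wpM2l// lef_pV2 ?posrE ?ltr0n// ler_nat dmn.
Qed.

(** If [p >= 2], both exponents are at least 2 and [m + n >= n]. If [p = 1], then [q >= 3] and a
    spare factor [m + n] replaces the missing [m]. *)
Lemma dominated_shuffle (K : numFieldType) (c : nat -> nat -> K^o) (B : K) (p q : nat) :
  (0 < p)%N -> (1 < q)%N -> (3 < p + q)%N ->
  (forall m n, `|c m n| <= B) ->
  dominated (fun m n => c m n / (m%:R ^+ p * (m + n)%:R ^+ q)).
Proof.
move=> p0 q1 pq cB.
apply: (@dominatedW _ _ B (fun m n => m ^ p * (m + n) ^ q)%N) => m n m0 n0.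
  apply: (@leq_trans (m ^ 2 * (m + n) ^ 2)).
    by rewrite leq_mul2l leq_exp2r// leq_addl orbT.
  case: p p0 pq => [//|[|p]] _ pq.
    rewrite expn1 -mulnn -mulnA leq_mul2l; apply/orP; right.
    apply: (@leq_trans ((m + n) ^ 3)).
      by rewrite [leqRHS]expnS leq_mul ?leq_addr.
    by rewrite leq_pexp2l ?addn_gt0 ?m0//; lia.
  by rewrite leq_mul// leq_pexp2l// addn_gt0 m0.
by rewrite -!natrX -natrM normrM normfV normr_nat ler_wpM2r.
Qed.

Lemma dominated_tr (K : numFieldType) (a : nat -> nat -> K^o) :
  dominated a -> dominated (fun m n => a n m).
Proof. by move=> [B aB]; exists B => m n m0 n0; rewrite mulnC; exact: aB. Qed.

(** * Existence of dominated double sums, real and then complex *)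

Section RealDoubleSums.
Variable R : realType.
Implicit Types a : nat -> nat -> R^o.

Lemma nondecreasing_sum_nat (F : nat -> R) :
  (forall i, (0 < i)%N -> 0 <= F i) ->
  nondecreasing_seq (fun n => \sum_(1 <= i < n) F i).
Proof.
move=> F0; apply/nondecreasing_seqP => -[|n]; first by rewrite !big_geq.
by rewrite [leRHS]big_nat_recr//= lerDl F0.
Qed.

(** Monotone convergence: the square sums increase, and every initial piece of a row fits in a large
    square. *)
Lemma dsum_nonneg a (M : R) :
  (forall m n, (0 < m)%N -> (0 < n)%N -> 0 <= a m n) ->
  (forall N, square_sum a N <= M) -> exists S, dsum a S.
Proof.
move=> a0 aM.
have rowS P N m : (P <= N)%N -> (0 < m)%N ->
    \sum_(1 <= n < P) a m n <= \sum_(1 <= n < N) a m n.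
  by move=> PN m0; apply: nondecreasing_sum_nat PN => i; exact: a0.
have row0 m N : (0 < m)%N -> 0 <= \sum_(1 <= n < N) a m n.
  by move=> m0; rewrite big_nat sumr_ge0// => i /andP[i0 _]; exact: a0.
have recS P N : (P <= N)%N ->
    \sum_(1 <= m < P) \sum_(1 <= n < N) a m n <= square_sum a N.
  move=> PN; apply: (@nondecreasing_sum_nat (fun m => \sum_(1 <= n < N) a m n)) PN => m.
  exact: row0.
have sqS : nondecreasing_seq (square_sum a).
  move=> P N PN; apply: le_trans (recS _ _ PN).
  rewrite /square_sum [leLHS]big_nat [leRHS]big_nat; apply: ler_sum => m /andP[m0 _].
  exact: rowS.
have sqcv : cvgn (square_sum a).
  by apply: nondecreasing_is_cvgn sqS _; exists M => _ [N _ <-]; exact: aM.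
have rowcv m : (0 < m)%N -> cvgn (fun N => \sum_(1 <= n < N) a m n).
  move=> m0; apply: nondecreasing_is_cvgn; first by move=> P N PN; exact: rowS.
  exists M => _ [N _ <-]; apply: le_trans (aM (maxn m.+1 N)).
  apply: le_trans (recS m.+1 _ (leq_maxl _ _)).
  rewrite big_nat_recr//= ler_wpDl//; last by apply: rowS => //; exact: leq_maxr.
  by rewrite big_nat sumr_ge0// => i /andP[i0 _]; exact: row0.
exists (limn (square_sum a)); split=> //.
exists (fun m => limn (fun N => \sum_(1 <= n < N) a m n)); split; first exact: rowcv.
(* The sum of the full rows below [P] lies between the square sum at [P] and the limit of the square
   sums. *)
apply: (@squeeze_cvgr _ \oo _ _ (square_sum a) (fun=> limn (square_sum a))) => //; last exact: cvg_cst.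
apply: nearW => P; apply/andP; split.
  rewrite /square_sum [leLHS]big_nat [leRHS]big_nat; apply: ler_sum => m /andP[m0 _].
  apply: (nondecreasing_cvgn_le _ (rowcv m m0)) => i j ij; exact: rowS.
(* Full rows are limits of [P] by [N] rectangles, which fit in the square at [N] once [P <= N]. *)
apply: (@cvgr_to_le _ \oo _ _ (fun N => \sum_(1 <= m < P) \sum_(1 <= n < N) a m n)).
  by apply: (@cvg_sum_nat R 1 P (fun m N => \sum_(1 <= n < N) a m n)) => m /andP[m0 _]; exact: rowcv.
near=> N; apply: (@le_trans _ _ (square_sum a N)); last exact: nondecreasing_cvgn_le.
by apply: recS; near: N; exact: nbhs_infty_ge.
Unshelve. all: end_near. Qed.

Lemma sum_inv_sqr_le2 N : \sum_(1 <= m < N) ((m ^ 2)%:R^-1 : R) <= 2.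
Proof.
(* The sharper bound makes the induction work, since 1/x - 1/(x+1) - 1/(x+1)^2 = 1/(x (x+1)^2) is
   nonnegative. *)
have H n : \sum_(1 <= m < n.+2) ((m ^ 2)%:R^-1 : R) <= 2 - n.+1%:R^-1.
  elim: n => [|n IH]; first by rewrite big_nat1 exp1n invr1 lerBrDr.
  rewrite big_nat_recr//=; apply: le_trans (lerD IH (lexx _)) _.
  rewrite -addrA lerD2l natrX -[n.+2%:R]natr1.
  have : (0 : R) < n.+1%:R by rewrite ltr0n.
  move: (n.+1%:R) => x x0.
  rewrite -subr_ge0 (_ : _ - _ = (x * (x + 1) ^+ 2)^-1).
    by rewrite invr_ge0 mulr_ge0 ?sqr_ge0// ltW.
  by field; rewrite !gt_eqF// addr_gt0.
case: N => [|[|n]]; [by rewrite big_geq|by rewrite big_geq|].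
by apply: le_trans (H n) _; rewrite lerBlDr lerDl invr_ge0.
Qed.

(** The majorant is a product, so its square sum factors into [B] and two partial sums of 1/m^2,
    each at most 2. *)
Lemma square_sum_dominated_le a (B : R) :
  (forall m n, (0 < m)%N -> (0 < n)%N -> `|a m n| <= B / (m ^ 2 * n ^ 2)%:R) ->
  forall N, square_sum (fun m n => `|a m n| : R^o) N <= B * (2 * 2).
Proof.
move=> aB N; have B0 : 0 <= B.
  by apply: le_trans (le_trans (normr_ge0 _) (aB 1%N 1%N _ _)) _; rewrite ?divr1.
pose H := \sum_(1 <= m < N) ((m ^ 2)%:R^-1 : R).
have H0 : 0 <= H by rewrite sumr_ge0// => i _; rewrite invr_ge0.
apply: (@le_trans _ _ (B * (H * H))); last first.
  by apply: ler_wpM2l => //; apply: ler_pM => //; exact: sum_inv_sqr_le2.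
rewrite big_distrlr big_distrr/= /square_sum [leLHS]big_nat [leRHS]big_nat.
apply: ler_sum => m /andP[m0 _].
rewrite big_distrr/= [leLHS]big_nat [leRHS]big_nat; apply: ler_sum => n /andP[n0 _].
by apply: le_trans (aB m n m0 n0) _; rewrite natrM invfM.
Qed.

(** Write [a] as [(|a| + a) - |a|], where both parts are nonnegative with bounded square sums. *)
Lemma dominated_dsum_real a : dominated a -> exists S, dsum a S.
Proof.
move=> [B aB]; have sq := square_sum_dominated_le aB.
have [S1 h1] : exists S, dsum (fun m n => `|a m n| : R^o) S.
  by apply: (dsum_nonneg (M := B * (2 * 2))) => // m n _ _.
have [S2 h2] : exists S, dsum (fun m n => `|a m n| + a m n : R^o) S.
  apply: (dsum_nonneg (M := B * (2 * 2) + B * (2 * 2))).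
    by move=> m n _ _; rewrite -lerBlDr sub0r -normrN ler_norm.
  move=> N; apply: le_trans (lerD (sq N) (sq N)).
  rewrite /square_sum -big_split/=; apply: ler_sum => m _.
  by rewrite -big_split/=; apply: ler_sum => n _; rewrite lerD2l ler_norm.
exists (S2 - S1); apply: eq_dsum (dsumB h2 h1) => m n _ _.
by rewrite addrAC subrr add0r.
Qed.

Local Open Scope complex_scope.

Lemma cvg_real_complex (u : nat -> R^o) (l : R^o) : u n @[n --> \oo] --> l ->
  ((u n)%:C : R[i]^o) @[n --> \oo] --> (l%:C : R[i]^o).
Proof.
move=> /cvgrPdist_lt ul; apply/cvgrPdist_lt => e e0.
have [x ex] : exists x, e = x%:C by apply/complex_realP; exact: gtr0_real.
have x0 : 0 < x by rewrite -ltcR -ex.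
near=> n; rewrite ex -rmorphB normc_def/= expr0n addr0 sqrtr_sqr ltcR.
by near: n; exact: ul.
Unshelve. all: end_near. Qed.

Lemma dsum_real_complex a S : dsum a S -> dsum (fun m n => (a m n)%:C : R[i]^o) S%:C.
Proof.
move=> [aS [r [ar rS]]]; split.
  have := cvg_real_complex aS; rewrite /square_sum.
  by under eq_fun do [rewrite rmorph_sum; under eq_bigr do rewrite rmorph_sum].
exists (fun m => (r m)%:C); split.
  by move=> m m0; have := cvg_real_complex (ar m m0); under eq_fun do rewrite rmorph_sum.
by have := cvg_real_complex rS; under eq_fun do rewrite rmorph_sum.
Qed.

Lemma dominated_dsum_complex (a : nat -> nat -> R[i]^o) :
  dominated a -> exists S, dsum a S.
Proof.
move=> [B aB].
(* [B] bounds the norm of [a 1 1], hence is real. *)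
have [b Bb] : exists b, B = b%:C.
  apply/complex_realP/ger0_real.
  by apply: le_trans (le_trans (normr_ge0 _) (aB 1%N 1%N _ _)) _; rewrite ?divr1.
have domr (f : R[i]^o -> R) : (forall z, `|f z|%:C <= `|z|) ->
    dominated (fun m n => f (a m n) : R^o).
  move=> fz; exists b => m n m0 n0; rewrite -lecR.
  have -> : (b / (m ^ 2 * n ^ 2)%:R)%:C = B / (m ^ 2 * n ^ 2)%:R.
    by rewrite Bb rmorphM fmorphV rmorph_nat.
  exact: le_trans (fz _) (aB _ _ m0 n0).
have [S1 h1] := dominated_dsum_real (domr (@complex.Re R) (@normc_ge_Re R)).
have [S2 h2] : exists S, dsum (fun m n => complex.Im (a m n) : R^o) S.
  apply: dominated_dsum_real; apply: (domr (@complex.Im R)) => z.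
  (* The bound on real parts is applied to [z * 'i], whose real part is minus the imaginary part of
     [z]. *)
  have := normc_ge_Re (z * 'i); rewrite ReiNIm normrN normrM.
  by rewrite [X in _ * X]normc_def/= expr0n expr1n add0r sqrtr1 mulr1.
exists (S1%:C + 'i * S2%:C).
apply: eq_dsum (dsumD (dsum_real_complex h1) (dsumZ 'i (dsum_real_complex h2))).
by move=> m n _ _; rewrite -complexE.
Qed.
End RealDoubleSums.

(** * The partial fraction identity *)

Section PartialFractions.
Variable K : numFieldType.

(** Induction on [k]: the sum for [k + 1] is the sum for [k] divided by [x], plus the term
    [nu = k + 2]. *)
Lemma double_zeta_partial_fractions (k : nat) (x y : K) :
  x != 0 -> y != 0 -> x + y != 0 ->
  \sum_(2 <= nu < k.+2) nu%:R / (x ^+ (k + 2 - nu) * (x + y) ^+ (nu + 1))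
    + (k + 1)%:R / (y ^+ 1 * (y + x) ^+ (k + 2))
    + (y ^+ 2 * (y + x) ^+ (k + 1))^-1
  = ((y ^+ 2)^-1 - ((y + x) ^+ 2)^-1) / x ^+ (k + 1).
Proof.
(* With [z] opaque, all denominators are monomials in [x], [y], [z], and [field] gets the linear
   relation [xE] between them. *)
rewrite (addrC x y) => x0 y0; have [z zE] : {z | z = y + x} by exists (y + x).
rewrite -zE => z0.
have xE : x = z - y by rewrite zE addrAC subrr add0r.
elim: k => [|k IH].
  by rewrite big_geq// add0r; field: xE; rewrite x0 y0 z0.
have -> : \sum_(2 <= nu < k.+3) nu%:R / (x ^+ (k.+1 + 2 - nu) * z ^+ (nu + 1)) =
    (\sum_(2 <= nu < k.+2) nu%:R / (x ^+ (k + 2 - nu) * z ^+ (nu + 1))) / x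
    + k.+2%:R / (x * z ^+ k.+3).
  rewrite big_nat_recr//= addn1 !addn2 subSnn expr1; congr (_ + _).
  rewrite big_distrl/= big_nat [RHS]big_nat; apply: eq_bigr => nu /andP[_ nuk].
  by rewrite subSn 1?ltnW// exprS -[RHS]mulrA -invfM -mulrA (mulrC x).
have -> : \sum_(2 <= nu < k.+2) nu%:R / (x ^+ (k + 2 - nu) * z ^+ (nu + 1)) =
    ((y ^+ 2)^-1 - (z ^+ 2)^-1) / x ^+ (k + 1) - (y ^+ 2 * z ^+ (k + 1))^-1
    - (k + 1)%:R / (y ^+ 1 * z ^+ (k + 2)).
  by rewrite -IH; ring.
rewrite !addn1 !addn2 !exprS -!natr1.
(* The powers of exponent [k] become atoms, leaving only numeric exponents for [field]. *)
have := expf_neq0 k x0; move: (x ^+ k) => X X0.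
have := expf_neq0 k z0; move: (z ^+ k) => Z Z0.
by field: xE; rewrite x0 y0 z0 X0 Z0.
Qed.
End PartialFractions.

(** * Double L-functions as double sums *)

Section DoubleLFunctions.
Variable R : realType.
Implicit Types (a : nat -> nat -> R[i]^o) (chi psi : nat -> R[i]^o).

(** Domination gives the transpose some sum; comparing squares identifies it with [S]. *)
Lemma dsum_tr a (S : R[i]^o) :
  dominated a -> dsum a S -> dsum (fun m n => a n m) S.
Proof.
move=> /dominated_tr/dominated_dsum_complex [T aT] aS.
by rewrite (dsum_tr_uniq _ aS aT).
Qed.

Lemma dsum_L2sh chi psi (B C : R[i]) (p q : nat) :
  (0 < p)%N -> (1 < q)%N -> (3 < p + q)%N ->
  (forall n, `|chi n| <= B) -> (forall n, `|psi n| <= C) ->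
  let a := fun m n => chi m * psi n / (m%:R ^+ p * (m + n)%:R ^+ q) in
  dominated a /\ dsum a (L2sh p q chi psi).
Proof.
move=> p0 q1 pq chiB psiC a.
have da : dominated a.
  apply: (@dominated_shuffle _ _ (B * C)) => // m n; rewrite normrM.
  exact: ler_pM.
split=> //; have [S aS] := dominated_dsum_complex da.
by rewrite /L2sh (dsum_lim aS).
Qed.

Lemma sum_nat_indic_shift (K : numFieldType) (g : nat -> K) (m N : nat) :
  \sum_(1 <= l < N + m) (if (m < l)%N then g l else 0) = \sum_(1 <= n < N) g (m + n)%N.
Proof.
case: N => [|N].
  rewrite add0n [RHS]big_geq// big_nat big1// => l /andP[_ lm].
  by rewrite ltnNge (ltnW lm).
rewrite (@big_cat_nat _ _ _ m.+1)//=; last by rewrite addSn ltnS leq_addl.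
rewrite [X in X + _]big_nat big1 ?add0r; last first.
  by move=> l /andP[_ lm]; rewrite ltnNge -ltnS lm.
rewrite -{1}[m.+1]add1n big_addn addnK; apply: eq_big_nat => n /andP[n0 _].
by rewrite addnC -{1}[m]addn0 ltn_add2l n0.
Qed.

(** The array is indexed by [m] and [l = m + n], with an indicator for [m < l], so that [psi]
    depends on one index alone and can be held fixed after transposition. *)
Lemma dsum_L2star chi psi (B C : R[i]) (p q : nat) :
  (1 < p)%N -> (1 < q)%N ->
  (forall n, `|chi n| <= B) -> (forall n, `|psi n| <= C) ->
  let a := fun m l : nat =>
    if (m < l)%N then chi m * psi l / (m%:R ^+ p * l%:R ^+ q) else 0 in
  dominated a /\ dsum a (L2star p q chi psi).
Proof.
move=> p1 q1 chiB psiC a.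
have da : dominated a.
  apply: (@dominatedW _ _ (B * C) (fun m n => m ^ p * n ^ q)%N) => m n m0 n0.
    by rewrite leq_mul// leq_pexp2l.
  have BC : `|chi m * psi n| <= B * C by rewrite normrM ler_pM.
  rewrite /a; case: ifP => _; last first.
    by rewrite normr0 mulr_ge0 ?invr_ge0 ?(le_trans _ BC).
  by rewrite -!natrX -natrM normrM normfV normr_nat ler_wpM2r.
split=> //; have [S aS] := dominated_dsum_complex da.
suff -> : L2star p q chi psi = S by [].
have [_ [r [ar _]]] := aS.
apply: cvg_lim => //; apply: dsum_iterated aS _ => m m0.
transitivity (r m).
  by apply: cvg_lim => //; exact: ar.
apply: esym; apply: cvg_lim => //.
(* The inner sum of [L2star] up to [N] is a row sum of [a] up to [N + m]; the shift does not change
   the limit. *)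
rewrite (_ : (fun N => _) = (fun N => \sum_(1 <= l < N + m) a m l)); last first.
  apply/funext => N.
  by rewrite (sum_nat_indic_shift (fun l => chi m * psi l / (m%:R ^+ p * l%:R ^+ q))).
by rewrite (cvg_shiftn m (fun N => \sum_(1 <= l < N) a m l)); exact: ar.
Qed.

(** With [H] the partial sums of 1/m^2, the sum up to [M] is [H M - H (M + l) + H l.+1], and the
    first two terms cancel in the limit. *)
Lemma cvg_telescope_inv_sqr (l : nat) :
  \sum_(1 <= m < M) (((m%:R : R[i]^o) ^+ 2)^-1 - ((m + l)%:R ^+ 2)^-1) @[M --> \oo]
  --> (\sum_(1 <= m < l.+1) (m%:R ^+ 2)^-1 : R[i]^o).
Proof.
pose H N : R[i]^o := \sum_(1 <= m < N) (m%:R ^+ 2)^-1.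
(* Convergence of [H] is read off row 1 of the dominated array 1/(m^2 n^2). *)
have [h Hh] : exists h : R[i]^o, H N @[N --> \oo] --> h.
  have [|S [_ [r [ar _]]]] :=
      @dominated_dsum_complex R (fun m n => ((m ^ 2 * n ^ 2)%:R^-1 : R[i]^o)).
    by exists 1 => m n _ _; rewrite div1r normfV normr_nat.
  exists (r 1%N); rewrite (_ : H = (fun N => \sum_(1 <= n < N) ((1 ^ 2 * n ^ 2)%:R^-1))).
    exact: ar.
  by apply/funext => N; apply: eq_bigr => n _; rewrite exp1n mul1n natrX.
pose u M : R[i]^o := \sum_(1 <= m < M) ((m%:R ^+ 2)^-1 - ((m + l)%:R ^+ 2)^-1).
(* The shift by one keeps the cut [l.+1] inside the range even for [M = 0]. *)
have uE : [sequence u (M + 1)%N]_M =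
    (fun M => H (M + 1)%N - H (M + l.+1)%N + H l.+1).
  apply/funext => M; rewrite /= /u sumrB -addrA; congr (_ + _).
  rewrite [H (M + _)%N](@big_cat_nat _ _ _ l.+1)//=; last exact: leq_addl.
  rewrite -/(H l.+1) opprD addrAC addNr add0r -{1}[l.+1]add1n big_addn.
  by have -> : (M + l.+1 - l = M + 1)%N by lia.
have : u @ \oo --> h - h + H l.+1.
  rewrite -(cvg_shiftn 1 u) uE; apply: cvgD; last exact: cvg_cst.
  by apply: cvgB; [rewrite (cvg_shiftn 1 H)|rewrite (cvg_shiftn l.+1 H)].
by rewrite subrr add0r.
Qed.
End DoubleLFunctions.

(** * The sum formula and its specialization to zeta values *)

Section Identities.
Variable R : realType.
Implicit Types chi : nat -> R[i]^o.

Lemma cvg_sum_nat_indic (K : numFieldType) (g : nat -> K^o) (l : nat) :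
  \sum_(1 <= n < N) (if (n < l)%N then g n else 0) @[N --> \oo] -->
  (\sum_(1 <= n < l) g n : K^o).
Proof.
have key N : (l <= N)%N ->
    \sum_(1 <= n < N) (if (n < l)%N then g n else 0) = \sum_(1 <= n < l) g n.
  case: l => [|l] lN; first by rewrite [RHS]big_geq// big1.
  rewrite (@big_cat_nat _ _ _ l.+1)//= [X in _ + X]big_nat [X in _ + X]big1 ?addr0.
    by apply: eq_big_nat => n /andP[_ ->].
  by move=> n /andP[ln _]; rewrite ltnNge ln.
apply: cvg_near_cst; near=> N; apply: key.
by near: N; exact: nbhs_infty_ge.
Unshelve. all: end_near. Qed.

Lemma double_L_sum_formula chi (B : R[i]) (k : nat) :
  (forall n, `|chi n| <= B) -> (1 <= k)%N ->
  \sum_(2 <= nu < k.+2) nu%:R * L2sh (k + 2 - nu)%N (nu + 1)%N chi chi0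
    + (k + 1)%:R * L2sh 1 (k + 2)%N chi0 chi
    + L2sh 2 (k + 1)%N chi0 chi
    - L2star 2 (k + 1)%N chi0 chi
  = dirichletL (k + 3)%N chi.
Proof.
move=> chiB k1.
have oneB n : `|chi0 n : R[i]^o| <= 1 by rewrite normr1.
set S := (LHS).
have [d1 s1] := dsum_L2sh (p := 1) (q := k + 2) isT ltac:(lia) ltac:(lia) oneB chiB.
have [d2 s2] := dsum_L2sh (p := 2) (q := k + 1) isT ltac:(lia) ltac:(lia) oneB chiB.
have [d3 s3] := dsum_L2star (p := 2) (q := k + 1) isT ltac:(lia) oneB chiB.
have sA nu : nu \in index_iota 2 k.+2 ->
    dsum (fun l n => nu%:R * (chi l * chi0 n / (l%:R ^+ (k + 2 - nu) * (l + n)%:R ^+ (nu + 1))))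
      (nu%:R * L2sh (k + 2 - nu)%N (nu + 1)%N chi chi0).
  rewrite mem_index_iota => /andP[nu2 nuk]; apply: dsumZ.
  by have [] := dsum_L2sh (p := k + 2 - nu) (q := nu + 1)
    ltac:(lia) ltac:(lia) ltac:(lia) chiB oneB.
(* Every array now has the argument [l] of [chi] as row index, which requires transposing the three
   arrays whose second character is [chi]. *)
have sT := dsumB (dsumD (dsumD (dsum_sum sA) (dsumZ (k + 1)%:R (dsum_tr d1 s1)))
  (dsum_tr d2 s2)) (dsum_tr d3 s3).
pose g l n : R[i]^o := chi0 n * chi l / (n%:R ^+ 2 * l%:R ^+ (k + 1)).
have {}sT : dsum (fun l n => chi l / l%:R ^+ (k + 1) *
    ((n%:R ^+ 2)^-1 - ((n + l)%:R ^+ 2)^-1) - (if (n < l)%N then g l n else 0)) S.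
  apply: eq_dsum sT => l n l0 n0; congr (_ - _).
  have lN0 : (l%:R : R[i]) != 0 by rewrite pnatr_eq0 -lt0n.
  have nN0 : (n%:R : R[i]) != 0 by rewrite pnatr_eq0 -lt0n.
  have lnN0 : (l%:R + n%:R : R[i]) != 0 by rewrite -natrD pnatr_eq0 -lt0n addn_gt0 l0.
  rewrite (natrD _ n l) -[RHS]mulrA [X in _ = _ * X]mulrC -(double_zeta_partial_fractions k lN0 nN0 lnN0).
  rewrite !mulrDr big_distrr/=; congr (_ + _ + _).
  - by apply: eq_bigr => nu _; rewrite mulr1 natrD mulrCA.
  - by rewrite mul1r mulrCA natrD.
  - by rewrite mul1r.
(* Reading the sum by rows, it remains to see that row [l] sums to [chi l / l%:R ^+ (k + 3)]. *)
apply: esym; apply: cvg_lim => //; apply: dsum_iterated sT _ => l l0.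
apply: cvg_lim => //.
(* The sum over [m <= l] minus the sum over [m < l] leaves the term 1/l^2. *)
have -> : chi l / l%:R ^+ (k + 3) =
    chi l / l%:R ^+ (k + 1) * (\sum_(1 <= m < l.+1) (m%:R ^+ 2)^-1) - \sum_(1 <= n < l) g l n.
  rewrite big_nat_recr//= mulrDr.
  have -> : \sum_(1 <= n < l) g l n =
      chi l / l%:R ^+ (k + 1) * \sum_(1 <= m < l) (m%:R ^+ 2)^-1.
    rewrite big_distrr/=; apply: eq_bigr => n _.
    by rewrite /g mul1r invfM mulrA mulrAC.
  by rewrite addrAC subrr add0r -mulrA -invfM -exprD -addnA.
under eq_fun do rewrite sumrB -big_distrr/=.
by apply: cvgB; [apply: cvgMl_tmp; exact: cvg_telescope_inv_sqr|exact: cvg_sum_nat_indic].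
Qed.

(** By periodicity every value occurs in one period, so the sum of the norms over a period is a
    bound. *)
Lemma dirichlet_char_bounded f chi :
  dirichlet_char f chi -> exists B, forall n, `|chi n| <= B.
Proof.
move=> [f0 _ per _]; exists (\sum_(i < f) `|chi i|) => n.
have -> : chi n = chi (n %% f)%N.
  rewrite {1}(divn_eq n f) addnC; elim: (n %/ f)%N => [|q IH]; first by rewrite addn0.
  by rewrite mulSn (addnC f) addnA per IH.
by rewrite (bigD1 (Ordinal (ltn_pmod n f0)))//= lerDl sumr_ge0.
Qed.

Local Open Scope complex_scope.

Lemma lim_real_complex (u : nat -> R^o) : cvgn u ->
  limn (fun n => (u n)%:C : R[i]^o) = (limn u)%:C.
Proof. by move=> cu; apply: cvg_lim => //; exact: cvg_real_complex. Qed.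

(** Both sides are sums of one array, seen in [R] and in [R[i]]; uniqueness of the sum identifies
    them. *)
Lemma L2sh_zeta2 (p q : nat) : (0 < p)%N -> (1 < q)%N -> (3 < p + q)%N ->
  L2sh p q chi0 chi0 = (zeta2 R p q)%:C.
Proof.
move=> p0 q1 pq.
have oneB n : `|chi0 n : R[i]^o| <= 1 by rewrite normr1.
have [_ sa] := dsum_L2sh p0 q1 pq oneB oneB.
pose b m n : R^o := (m%:R ^+ p * (m + n)%:R ^+ q)^-1.
have [S bS] : exists S, dsum b S.
  apply: dominated_dsum_real.
  have [|B h] := @dominated_shuffle R (fun _ _ => 1) 1 p q p0 q1 pq.
    by move=> m n; rewrite normr1.
  by exists B => m n m0 n0; rewrite /b -[_^-1]mul1r; exact: h.
have -> : zeta2 R p q = S by exact: dsum_lim bS.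
apply: esym; apply: dsum_uniq sa.
apply: eq_dsum (dsum_real_complex bS) => m n _ _.
by rewrite !mul1r fmorphV rmorphM !rmorphXn !rmorph_nat.
Qed.

Lemma dirichletL_zeta (s : nat) : (1 < s)%N -> dirichletL s chi0 = (zeta R s)%:C.
Proof.
move=> s1; rewrite /dirichletL /zeta -lim_real_complex.
  rewrite (_ : (fun N => \sum_(1 <= n < N) chi0 n / n%:R ^+ s) =
    (fun N => (\sum_(1 <= n < N) (n%:R ^+ s)^-1)%:C))//.
  apply/funext => N; rewrite rmorph_sum; apply: eq_bigr => n _.
  by rewrite mul1r fmorphV rmorphXn rmorph_nat.
(* Row 1 of this array is the zeta series, so domination yields its convergence. *)
pose b m n : R^o := (m%:R ^+ s * n%:R ^+ s)^-1.
have [S [_ [r [br _]]]] : exists S, dsum b S.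
  apply: dominated_dsum_real; apply: (@dominatedW _ _ 1 (fun m n => m ^ s * n ^ s)%N).
    by move=> m n m0 n0; rewrite leq_mul// leq_pexp2l.
  by move=> m n _ _; rewrite /b -!natrX -natrM normfV normr_nat div1r.
apply/cvg_ex; exists (r 1%N); have := br 1%N isT.
by rewrite /b; under eq_fun do under eq_bigr do rewrite expr1n mul1r.
Qed.
End Identities.

Local Close Scope classical_set_scope.

Theorem corollary1p5 (R : realType) :
  (forall (f : nat) (chi : nat -> R[i]^o), primitive_char f chi ->
   forall k : nat, (1 <= k)%N ->
     \sum_(2 <= nu < k.+2) nu%:R * L2sh (k + 2 - nu)%N (nu + 1)%N chi chi0
       + (k + 1)%:R * L2sh 1 (k + 2)%N chi0 chi
       + L2sh 2 (k + 1)%N chi0 chi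
       - L2star 2 (k + 1)%N chi0 chi
     = dirichletL (k + 3)%N chi)
  /\
  (forall k : nat, (1 <= k)%N ->
     \sum_(2 <= nu < k.+1) nu%:R * zeta2 R (k + 2 - nu)%N (nu + 1)%N
       + 2 * (k + 1)%:R * zeta2 R 1 (k + 2)%N
     = zeta R (k + 3)%N).
Proof.
split=> [f chi [/dirichlet_char_bounded[B chiB] _] k k1|k k1].
  exact: double_L_sum_formula chiB k1.
have oneB n : `|chi0 n : R[i]^o| <= 1 by rewrite normr1.
apply: (@complexI R); rewrite -dirichletL_zeta ?addn3//.
rewrite -addn3 -(double_L_sum_formula oneB k1).
(* Both numerators are [1 * 1], so the two series are convertible. *)
have -> : L2star 2 (k + 1) chi0 chi0 = L2sh 2 (k + 1) chi0 chi0 :> R[i] by [].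
have eq1 : (k + 2 - k.+1 = 1)%N by lia.
(* The term [nu = k + 1] is [(k + 1) * zeta2 R 1 (k + 2)]; with the equal term next to it, it
   accounts for the factor 2. *)
rewrite addrK [X in _ = X + _]big_nat_recr//= eq1 !addn1 !addn2 L2sh_zeta2//.
rewrite -addrA rmorphD rmorph_sum; congr (_ + _); last first.
  by rewrite !rmorphM/= !rmorph_nat; ring.
apply: eq_big_nat => nu /andP[nu2 nuk].
by rewrite rmorphM rmorph_nat L2sh_zeta2//; lia.
Qed.
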